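(* Let $N\ge 1$ be an integer and $p\in(0,\frac1N)$. Let $X_{N,p}$ be a random variable with the Avalanche distribution with parameters $N,p$. Then $$E(X_{N,p})=\sum_{i=1}^{N}\frac{N!}{(N-i)!}\,p^i.$$
   Context: For an integer $N\ge 1$ and $p\in(0,\frac1N)$, the Avalanche distribution with parameters $N,p$ is the probability distribution on $\{0,1,2,\dots,N\}$ given by $$P(X_{N,p}=b)=\binom{N}{b}p^{b}\,(1-(b+1)p)^{N-b}\,(b+1)^{b-1},\qquad b=0,1,\dots,N,$$ with the convention $0^0=1$. (It is known that these values sum to $1$.) $E$ denotes expectation. *)

(* Defs.v *)
From mathcomp Require Import all_boot all_order all_algebra.
From mathcomp Require Import all_classical all_reals all_analysis.

Set Implicit Arguments.
Unset Strict Implicit.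
Unset Printing Implicit Defensive.

Import Order.TTheory GRing.Theory Num.Theory.
Import numFieldNormedType.Exports.

Local Open Scope classical_set_scope.
Local Open Scope ring_scope.

(* The last exponent is the integer b - 1, equal to -1 at b = 0. At b = N the
   power of 1 - (N + 1) p is x ^+ 0 = 1, including when x = 0. *)
Definition avalanche_pmf (R : realType) (N : nat) (p : R) (b : nat) : R :=
  'C(N, b)%:R * p ^+ b * (1 - b.+1%:R * p) ^+ (N - b)
    * b.+1%:R ^ (b%:Z - 1).

(* The first conjunct says that the law of X is carried by {0, ..., N}; since
   the values of avalanche_pmf sum to 1 for 0 < p < 1/N, it follows from the
   second one in that range. *)
Definition has_avalanche_distribution (d : measure_display)
    (T : measurableType d) (R : realType) (P : probability T R)
    (X : {RV P >-> R}) (N : nat) (p : R) : Prop :=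
  P [set t | exists2 b : nat, (b <= N)%N & X t = b%:R] = 1%E /\
  (forall b : nat, (b <= N)%N ->
     P [set t | X t = b%:R] = (avalanche_pmf N p b)%:E).

Arguments has_avalanche_distribution {d T R} P X N p.

(* Main.v *)
Require Import Defs.
From mathcomp Require Import all_boot all_order all_algebra.
From mathcomp Require Import all_classical all_reals all_analysis.
From mathcomp Require Import measurable_realfun.
From mathcomp Require Import ring zify.

Import Order.TTheory GRing.Theory Num.Theory.
Import numFieldNormedType.Exports.

Local Open Scope classical_set_scope.
Local Open Scope ring_scope.

(** In the sum over b of b * P (X = b), the factor b cancels against the
    binomial coefficient: b * 'C(N, b) = N * 'C(N - 1, b - 1).  The term
    b = 0 vanishes, and with it the only negative power; with c = b - 1 the mean
    becomes N * p times
      sum_c 'C(N - 1, c) p ^ c (1 - (2 + c) p) ^ (N - 1 - c) (2 + c) ^ c.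
    This is an Abel sum, the case n = N - 1, x = 2, y = 1 of [abel_sum].
    Abel sums do not depend on the shift x: expand the power of
    y - (x + c) p by the binomial formula and collect the powers of y.  What
    multiplies 'C(n, k) p ^ k y ^ (n - k) is
      sum_c 'C(k, c) (-1) ^ (k - c) (x + c) ^ k,
    the k-th finite difference of the monomial of degree k, which is the
    constant k! ([sum_binom_sign_power]).  As 'C(n, k) * k! is the falling
    factorial of n, the mean is the sum over k of
    N * (N - 1) ^_ k * p ^ (k + 1), which is the claimed formula with
    i = k + 1.  The argument is an identity of polynomials in p; the
    distribution enters only through [expectation_nat_bounded], which turns
    the integral into the finite sum. *)

(** A k-th finite difference annihilates polynomials of degree below k and
    sends the monomial of degree k to k!.  The induction is on the degree m,
    for all k and x at once: splitting one factor x + c off the power, the part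
    with x keeps the difference of order k, and the part with c, by
    c * 'C(k, c) = k * 'C(k - 1, c - 1), is a difference of order k - 1 at
    x + 1. *)
Lemma sum_binom_sign_power (R : comNzRingType) (k m : nat) (x : R) :
  (m <= k)%N ->
  \sum_(c < k.+1) 'C(k, c)%:R * (-1) ^+ (k - c) * (x + c%:R) ^+ m =
    (k`! * (m == k))%:R.
Proof.
elim: m k x => [|m IHm] k x lemk.
  transitivity ((-1 + 1) ^+ k : R).
    rewrite exprDn; apply: eq_bigr => c _.
    by rewrite expr0 mulr1 expr1n mulr1 mulr_natl.
  by rewrite addNr expr0n; case: k lemk => [|k] _ /=; rewrite ?fact0 ?muln0.
case: k lemk => [//|k] lemk.
transitivity (x * (\sum_(c < k.+2) 'C(k.+1, c)%:R * (-1) ^+ (k.+1 - c)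
                     * (x + c%:R) ^+ m)
   + k.+1%:R * (\sum_(c < k.+1) 'C(k, c)%:R * (-1) ^+ (k - c)
                     * ((x + 1) + c%:R) ^+ m)).
  have -> : k.+1%:R * (\sum_(c < k.+1) 'C(k, c)%:R * (-1) ^+ (k - c)
                     * ((x + 1) + c%:R) ^+ m) =
     \sum_(c < k.+2) c%:R * ('C(k.+1, c)%:R * (-1) ^+ (k.+1 - c)
                     * (x + c%:R) ^+ m) :> R.
    rewrite [RHS]big_ord_recl mul0r add0r big_distrr /=.
    apply: eq_bigr => c _.
    rewrite /bump /= add1n subSS -addrA [1 + _]addrC natr1.
    by rewrite !mulrA -!natrM mul_bin_diag.
  rewrite big_distrr -big_split /=; apply: eq_bigr => c _.
  by rewrite exprSr; ring.
rewrite IHm; last exact: ltnW.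
rewrite IHm //.
by rewrite (ltn_eqF lemk) muln0 mulr0 add0r -natrM mulnA -factS.
Qed.

(** The binomial expansion of (y + z) ^ (n - c), reindexed by k = c + i and
    regrouped with 'C(n, c) * 'C(n - c, k - c) = 'C(n, k) * 'C(k, c).  The range
    of k is extended down to 0, where 'C(k, c) vanishes, so that it does not
    depend on c and the double sum in [abel_sum] is over a rectangle. *)
Lemma bin_mul_exprD (R : comNzRingType) (n c : nat) (y z : R) :
  (c <= n)%N ->
  'C(n, c)%:R * (y + z) ^+ (n - c) =
    \sum_(k < n.+1) ('C(n, k) * 'C(k, c))%:R * y ^+ (n - k) * z ^+ (k - c).
Proof.
move=> lecn.
rewrite -(big_mkord xpredT
  (fun k => ('C(n, k) * 'C(k, c))%:R * y ^+ (n - k) * z ^+ (k - c))).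
rewrite (@big_cat_nat _ _ _ c) //=; last exact: leqW.
rewrite big_nat big1 ?add0r; last first.
  by move=> k /andP[_ ltkc]; rewrite (bin_small ltkc) muln0 !mul0r.
rewrite -[X in \sum_(X <= _ < _) _]add0n big_addn subSn // big_mkord exprDn big_distrr /=.
apply: eq_bigr => i _.
have lei : (i <= n - c)%N by rewrite -ltnS.
have binE : ('C(n, i + c) * 'C(i + c, c) = 'C(n, c) * 'C(n - c, i))%N.
  have le1 : (i + c <= n)%N by rewrite addnC -leq_subRL.
  have lecic : (c <= i + c)%N by exact: leq_addl.
  (* Times c! i! (n - c - i)!, both sides are n!. *)
  apply/eqP; rewrite -(eqn_pmul2r (fact_gt0 c)) -(eqn_pmul2r (fact_gt0 i)).
  rewrite -(eqn_pmul2r (fact_gt0 (n - c - i))); apply/eqP.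
  have E1 := bin_fact le1; have E2 := bin_fact lecic.
  have E3 := bin_fact lecn; have E4 := bin_fact lei.
  rewrite addnK in E2; rewrite addnC subnDA in E1.
  transitivity (n`!).
    by rewrite -E1 [(c + i)%N]addnC -E2; lia.
  by rewrite -E3 -E4; lia.
rewrite binE addnK addnC subnDA -mulr_natl natrM; ring.
Qed.

(** Abel's binomial identity, in a form whose right-hand side shows the
    independence of x: exchanging the sums leaves in front of y ^ (n - k) a
    k-th finite difference of a polynomial in x of degree k, hence a
    constant. *)
Lemma abel_sum (R : comNzRingType) (n : nat) (p x y : R) :
  \sum_(c < n.+1) 'C(n, c)%:R * p ^+ c * (y - (x + c%:R) * p) ^+ (n - c)
     * (x + c%:R) ^+ c =
  \sum_(k < n.+1) (n ^_ k)%:R * p ^+ k * y ^+ (n - k).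
Proof.
transitivity (\sum_(c < n.+1) \sum_(k < n.+1)
   ('C(n, k) * 'C(k, c))%:R * y ^+ (n - k) * (- ((x + c%:R) * p)) ^+ (k - c)
     * p ^+ c * (x + c%:R) ^+ c).
  apply: eq_bigr => c _.
  rewrite [_ * p ^+ c]mulrC -[X in X * _]mulrA.
  have lecn : (c <= n)%N by rewrite -ltnS.
  rewrite bin_mul_exprD // big_distrr big_distrl /=; apply: eq_bigr => k _.
  by ring.
rewrite exchange_big /=; apply: eq_bigr => k _.
rewrite -(big_mkord xpredT (fun c => ('C(n, k) * 'C(k, c))%:R * y ^+ (n - k)
  * (- ((x + c%:R) * p)) ^+ (k - c) * p ^+ c * (x + c%:R) ^+ c)).
rewrite (@big_cat_nat _ _ _ k.+1) //=.
rewrite [X in _ + X]big_nat [X in _ + X]big1 ?addr0; last first.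
  by move=> c /andP[ltkc _]; rewrite (bin_small ltkc) muln0 !mul0r.
rewrite big_mkord.
transitivity ('C(n, k)%:R * p ^+ k * y ^+ (n - k) *
  \sum_(c < k.+1) 'C(k, c)%:R * (-1) ^+ (k - c) * (x + c%:R) ^+ k).
  rewrite big_distrr; apply: eq_bigr => c _ /=.
  have leck : (c <= k)%N by rewrite -ltnS.
  have expkE (z : R) : z ^+ k = z ^+ (k - c) * z ^+ c by rewrite -exprD subnK.
  by rewrite !expkE (exprNn (_ * p)) exprMn natrM; ring.
rewrite sum_binom_sign_power // eqxx muln1 -bin_ffact natrM.
by ring.
Qed.

(** Almost surely X is the sum of the simple functions equal to b on the event
    X = b and to 0 elsewhere; these are nonnegative, so the integral may be
    taken term by term. *)
Lemma expectation_nat_bounded (d : measure_display) (T : measurableType d)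
    (R : realType) (P : probability T R) (X : {RV P >-> R}) (N : nat) :
  P [set t | exists2 b : nat, (b <= N)%N & X t = b%:R] = 1%E ->
  'E_P[X]%E = (\sum_(b < N.+1) b%:R%:E * P [set t | X t = b%:R])%E.
Proof.
move=> PX1.
have mX b : measurable [set t | X t = b%:R].
  by have := measurable_funPT X measurableT _ (measurable_set1 b%:R); rewrite setTI.
have UE : [set t | exists2 b : nat, (b <= N)%N & X t = b%:R] =
    \bigcup_(b in `I_N.+1) [set t | X t = b%:R] by [].
have mU : measurable [set t | exists2 b : nat, (b <= N)%N & X t = b%:R].
  by rewrite UE; apply: bigcup_measurable => b _; exact: mX.
rewrite unlock.
rewrite (@ae_eq_integral _ _ _ P setT
  (fun t => \sum_(b < N.+1) (b%:R * \1_[set t | X t = b%:R] t)%:E)%E) //.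
- rewrite ge0_integral_sum //.
  + apply: eq_bigr => b _.
    under eq_integral do rewrite EFinM.
    rewrite ge0_integralZl_EFin //; first by rewrite integral_indic ?setIT.
    by apply/measurable_EFinP; exact: measurable_indic.
  + by move=> b; apply/measurable_EFinP; exact: measurable_funM.
- exact/measurable_EFinP.
- apply: emeasurable_sum => b; apply/measurable_EFinP.
  exact: measurable_funM.
(* The two functions agree on the event where X is one of 0, ..., N. *)
- exists (~` [set t | exists2 b : nat, (b <= N)%N & X t = b%:R]); split.
  + exact: measurableC.
  + by rewrite [LHS](probability_setC P mU) PX1 subee.
  + apply: subsetC => t [b lebN Xt] _.
    rewrite sumEFin Xt; congr EFin.
    rewrite (bigD1 (Ordinal (n := N.+1) (m := b) lebN)) //= big1.
      by rewrite indicE mem_set // mulr1 addr0.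
    move=> i nib; rewrite indicE memNset ?mulr0 //= Xt => /eqP.
    by rewrite eqr_nat => /eqP Eb; case/eqP: nib; apply: val_inj.
Qed.

Theorem lemma2p2 (R : realType) (N : nat) (hN : (1 <= N)%N)
    (p : R) (hp : 0 < p < N%:R^-1)
    (d : measure_display) (T : measurableType d) (P : probability T R)
    (X : {RV P >-> R}) (hX : has_avalanche_distribution P X N p) :
  'E_P[X]%E = (\sum_(1 <= i < N.+1) (N`!%:R / (N - i)`!%:R) * p ^+ i)%:E.
Proof.
case: hX => PX1 pmfX; rewrite (expectation_nat_bounded _ _ _ _ _ _ PX1).
case: N hN {hp} PX1 pmfX => [//|n] _ _ pmfX.
under eq_bigr => b _ do rewrite pmfX -1?ltnS // -EFinM.
rewrite sumEFin; congr EFin.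
(* The term b = 0, the only one with a negative power, has weight 0. *)
rewrite big_ord_recl mul0r add0r.
transitivity (n.+1%:R * p * \sum_(c < n.+1) 'C(n, c)%:R * p ^+ c
   * (1 - (2 + c%:R) * p) ^+ (n - c) * (2 + c%:R) ^+ c).
  rewrite big_distrr; apply: eq_bigr => c _ /=.
  rewrite /bump /= add1n /avalanche_pmf subSS.
  have -> : (c.+1 : int) - 1 = c by rewrite -addn1 PoszD addrK.
  have -> : c.+2%:R = 2 + c%:R :> R by rewrite -natrD.
  by rewrite -exprnP exprS !mulrA -natrM -mul_bin_diag natrM; ring.
rewrite abel_sum big_distrr big_add1 big_mkord /=.
apply: eq_bigr => i _.
have lei : (i <= n)%N by rewrite -ltnS.
rewrite expr1n mulr1 subSS exprS.
rewrite factS -(ffact_fact lei) !natrM !mulrA mulfK; last first.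
  by rewrite pnatr_eq0 -lt0n fact_gt0.
by ring.
Qed.
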